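(* The map $\mathrm T=\mathrm I\circ\mathrm{Ro}:\mathcal I^+\to\mathcal I^+$ completely determines the dynamics of the knife-edge billiard in the disk via the recurrence relation $\mathrm T(z_i^+)=z_{i+1}^+$; that is, if $z_i^+\in\mathcal I^+$ is the $i$-th post-impact state, then the $(i+1)$-st post-impact state is $z_{i+1}^+=\mathrm T(z_i^+)$.
   Context: **Setting.** Let $R,\ell,m,J>0$. The knife-edge is a segment of length $2\ell$, mass $m$, moment of inertia $J$ about its midpoint, with center of mass at the midpoint. A configuration is $q=(\theta,p)\in SE(2)$, with orientation $[\theta]\in\mathbb S^1=\mathbb R/2\pi\mathbb Z$ and midpoint $p\in\mathbb R^2$. Its front and back points are $p_f=p+\ell(\cos\theta,\sin\theta)$ and $p_b=p-\ell(\cos\theta,\sin\theta)$. The table is the closed disk of radius $R$ centered at the origin; the impact surface is $\{h(q)=R^2\}$ with $h(q)=\max\{\|p_f\|^2,\|p_b\|^2\}$. In the smooth dynamics the quasi-velocities $(\omega,v)$ are constant and $\dot\theta=\omega$, $\dot p=v(\cos\theta,\sin\theta)$. **Impact states.** Write $z=([\phi],[\vartheta],\omega,v)\in\mathbb T^2\times(\mathbb R^2\setminus\{(0,0)\})$, $\mathbb T^2=\mathbb S^1\times\mathbb S^1$. Set $\mathcal I_f=\{z:\ \ell/R<\cos\vartheta\}$ (front-type), $\mathcal I_b=\{z:\ \ell/R<-\cos\vartheta\}$ (back-type), $\mathcal I=\mathcal I_f\cup\mathcal I_b$. The point $z$ represents the configuration with $\theta(z)=\phi-\vartheta$ and $p_f=R(\cos\phi,\sin\phi)$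 if $z\in\mathcal I_f$ (respectively $p_b=R(\cos\phi,\sin\phi)$ if $z\in\mathcal I_b$), so the midpoint is $p(z)=R(\cos\phi,\sin\phi)\mp\ell(\cos(\phi-\vartheta),\sin(\phi-\vartheta))$ with $-$ for front-type and $+$ for back-type; $(\omega,v)$ are its quasi-velocities. Put $N(z)=\ell\omega\sin\vartheta+v\cos\vartheta$ for $z\in\mathcal I_f$ and $N(z)=v\cos\vartheta-\ell\omega\sin\vartheta$ for $z\in\mathcal I_b$. Set $\mathcal{RI}^-=\{N>0\}$, $\mathcal{RI}^+=\{N<0\}$, $\mathcal{TI}=\{N=0\}$ (subsets of $\mathcal I$), $\mathcal I^\pm=\mathcal{RI}^\pm\cup\mathcal{TI}$ (pre-/post-impact states), $\mathcal I_f^-=\mathcal I^-\cap\mathcal I_f$, $\mathcal I_b^-=\mathcal I^-\cap\mathcal I_b$. **Coupled circle map.** Let $\mathcal{RI}_v^+=\{z\in\mathcal{RI}^+:\omega=0\}$. For $z\in\mathcal I^+\setminus\mathcal{RI}^+_v$ (where $\omega\ne0$) let $\mathrm c(z)=p(z)+\frac v\omega(-\sin(\phi-\vartheta),\cos(\phi-\vartheta))$, $d=\|\mathrm c(z)\|$, $r=\sqrt{(v/\omega)^2+\ell^2}$, $\alpha=\arccos\frac{d^2+R^2-r^2}{2dR}$. Define $\Omega:\mathcal I^+\to\mathbb S^1$ by $\Omega(z)=[-2\,\mathrm{sgn}(\omega)\alpha(z)]$ if $z\notin\mathcal{RI}_v^+$ and $\Omega(z)=[-2\vartheta+\pi]$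 if $z\in\mathcal{RI}_v^+$. Then $\mathrm{Ro}:\mathcal I^+\to\mathcal I^-$, $\mathrm{Ro}(z)=([\phi]+\Omega(z),[-\vartheta+\pi],\omega,v)$. **Impact map.** With $\mathrm D(\vartheta)=\frac{\ell^2}{J}\sin^2\vartheta+\frac1m\cos^2\vartheta$, the elastic impact map is $\mathrm I:\mathcal I^-\to\mathcal I^+$, $\mathrm I(z)=(\phi,\vartheta,\mathcal R_f^\vartheta(\omega,v))$ if $z\in\mathcal I_f^-$ and $\mathrm I(z)=(\phi,\vartheta,\mathcal R_b^\vartheta(\omega,v))$ if $z\in\mathcal I_b^-$, where (row vector times matrix) $$\mathcal R_{f}^\vartheta(\omega,v)=(\omega,v)\begin{pmatrix}1-\frac{2\ell^2\sin^2\vartheta}{J\mathrm D(\vartheta)}&-\frac{2\ell\cos\vartheta\sin\vartheta}{m\mathrm D(\vartheta)}\\-\frac{2\ell\cos\vartheta\sin\vartheta}{J\mathrm D(\vartheta)}&1-\frac{2\cos^2\vartheta}{m\mathrm D(\vartheta)}\end{pmatrix},$$ and $\mathcal R_b^\vartheta$ is given by the same matrix with both off-diagonal entries replaced by their negatives. **Hybrid dynamics.** From a post-impact state $z_i^+\in\mathcal I^+$ at time $t_i$, follow the smooth dynamics until the first time $t_{i+1}>t_i$ with $h(q(t))=R^2$; the coordinate of the state reached is the pre-impact state $z_{i+1}^-\in\mathcal I^-$. The next post-impact state is $z_{i+1}^+=\mathrm I(z_{i+1}^-)$. *)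

(* Defs.v *)
From HB Require Import structures.
From mathcomp Require Import all_boot all_order all_algebra.
From mathcomp Require Import ring_quotient.
From mathcomp Require Import all_classical all_reals all_analysis.
Import Order.TTheory GRing.Theory Num.Theory.
Import numFieldNormedType.Exports.

Set Implicit Arguments.
Unset Strict Implicit.
Unset Printing Implicit Defensive.

Local Open Scope classical_set_scope.
Local Open Scope ring_scope.
Local Open Scope quotient_scope.

Definition two_pi_Z (R : realType) : {pred R} :=
  fun x => `[< exists k : int, x = (pi *+ 2) *~ k >].

Lemma two_pi_Z_zmod_closed (R : realType) : zmod_closed (@two_pi_Z R).
Proof.
split=> [|x y /asboolP[k ->] /asboolP[l ->]]; apply/asboolP.
  by exists 0; rewrite mulr0z.
by exists (k - l); rewrite mulrzBr.
Qed.

HB.instance Definition _ (R : realType) :=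
  GRing.isZmodClosed.Build R (@two_pi_Z R) (@two_pi_Z_zmod_closed R).

(* R / 2 pi Z with its additive group structure. *)
Definition circle (R : realType) : zmodType := Quotient.quot (@two_pi_Z R).

Definition angle (R : realType) (x : R) : circle R := \pi_(Quotient.quot (@two_pi_Z R)) x.

Definition angle_rep (R : realType) (a : circle R) : R :=
  repr (a : Quotient.quot (@two_pi_Z R)).

Definition cosS (R : realType) (a : circle R) : R := cos (angle_rep a).
Definition sinS (R : realType) (a : circle R) : R := sin (angle_rep a).

Lemma angle_repK (R : realType) (a : circle R) : angle (angle_rep a) = a.
Proof. exact: (@reprK _ (Quotient.quot (@two_pi_Z R))). Qed.

Lemma angle_eq (R : realType) (x y : R) :
  angle x = angle y <-> exists k : int, x - y = (pi *+ 2) *~ k.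
Proof.
split=> [/eqP|xy].
  by rewrite /angle -Quotient.idealrBE => /asboolP.
by apply/eqP; rewrite /angle -Quotient.idealrBE; apply/asboolP.
Qed.

Lemma periodicz (R : realType) (f : R -> R) (T : R) :
  periodic f T -> forall (k : int) a, f (a + T *~ k) = f a.
Proof.
move=> fT [n|n] a; first exact: periodicn.
by rewrite NegzE mulrNz -[in RHS](subrK (T *~ n.+1) a) periodicn.
Qed.

Lemma cosS_angle (R : realType) (x : R) : cosS (angle x) = cos x.
Proof.
have [k e] := (angle_eq (angle_rep (angle x)) x).1 (angle_repK _).
by rewrite /cosS -(subrK x (angle_rep _)) e addrC (periodicz (@cosD2pi R)).
Qed.

Lemma sinS_angle (R : realType) (x : R) : sinS (angle x) = sin x.
Proof.
have [k e] := (angle_eq (angle_rep (angle x)) x).1 (angle_repK _).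
by rewrite /sinS -(subrK x (angle_rep _)) e addrC (periodicz (@sinD2pi R)).
Qed.

(* The library's norm on [R * R] is the sup norm, hence this definition. *)
Definition sqnorm2 (R : realType) (p : R * R) : R := p.1 ^+ 2 + p.2 ^+ 2.
Definition norm2 (R : realType) (p : R * R) : R := Num.sqrt (sqnorm2 p).

Definition dir (R : realType) (a : circle R) : R * R := (cosS a, sinS a).
Definition normal_dir (R : realType) (a : circle R) : R * R := (- sinS a, cosS a).
Definition scale2 (R : realType) (k : R) (p : R * R) : R * R := (k * p.1, k * p.2).

Record config (R : realType) := Config {
  orient : circle R;
  midpt : R * R }.

(* A point of T^2 x R^2; the condition (omega, v) <> (0, 0) is part of
   [impact_f] and [impact_b] below, hence of every set of states built on
   them. *)
Record state (R : realType) := State {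
  phi : circle R;
  vth : circle R;
  omega : R;
  vel : R }.

Definition nonrest (R : realType) (z : state R) : Prop :=
  (omega z, vel z) <> (0, 0).

Section Billiard.
Context {R : realType}.
(* radius of the table; half-length, mass and moment of inertia of the blade *)
Context (Rad ell m J : R).
Implicit Types (q : config R) (z : state R).

Definition front_pt q : R * R := midpt q + scale2 ell (dir (orient q)).
Definition back_pt q : R * R := midpt q - scale2 ell (dir (orient q)).

Definition h q : R := Num.max (sqnorm2 (front_pt q)) (sqnorm2 (back_pt q)).

Definition impact_f : set (state R) :=
  [set z | nonrest z /\ ell / Rad < cosS (vth z)].
Definition impact_b : set (state R) :=
  [set z | nonrest z /\ ell / Rad < - cosS (vth z)].
Definition impact : set (state R) := impact_f `|` impact_b.

(* In the definitions by cases below, the last branch is only meaningful for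
   back-type states; [impact_f] and [impact_b] are disjoint for positive
   parameters. *)
Definition theta_of z : circle R := phi z - vth z.

Definition mid_of z : R * R :=
  if z \in impact_f
  then scale2 Rad (dir (phi z)) - scale2 ell (dir (theta_of z))
  else scale2 Rad (dir (phi z)) + scale2 ell (dir (theta_of z)).

Definition config_of z : config R := Config (theta_of z) (mid_of z).

Definition N z : R :=
  if z \in impact_f
  then ell * omega z * sinS (vth z) + vel z * cosS (vth z)
  else vel z * cosS (vth z) - ell * omega z * sinS (vth z).

Definition RI_minus : set (state R) := [set z | impact z /\ 0 < N z].
Definition RI_plus : set (state R) := [set z | impact z /\ N z < 0].
Definition TI : set (state R) := [set z | impact z /\ N z = 0].
Definition I_minus : set (state R) := RI_minus `|` TI.
Definition I_plus : set (state R) := RI_plus `|` TI.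
Definition I_f_minus : set (state R) := I_minus `&` impact_f.
Definition I_b_minus : set (state R) := I_minus `&` impact_b.

Definition RI_v_plus : set (state R) := [set z | RI_plus z /\ omega z = 0].

Definition rot_center z : R * R :=
  mid_of z + scale2 (vel z / omega z) (normal_dir (theta_of z)).
Definition rot_dist z : R := norm2 (rot_center z).
Definition rot_radius z : R :=
  Num.sqrt ((vel z / omega z) ^+ 2 + ell ^+ 2).
Definition alpha z : R :=
  acos ((rot_dist z ^+ 2 + Rad ^+ 2 - rot_radius z ^+ 2)
        / (2 * rot_dist z * Rad)).

Definition Omega z : circle R :=
  if z \in RI_v_plus then - (vth z *+ 2) + angle pi
  else angle (- 2 * Num.sg (omega z) * alpha z).

Definition Ro z : state R :=
  State (phi z + Omega z) (- vth z + angle pi) (omega z) (vel z).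

Definition row2 (a b : R) : 'rV[R]_2 :=
  \row_(j < 2) (if j == 0 then a else b).
Definition mx2 (a b c d : R) : 'M[R]_2 :=
  \matrix_(i < 2, j < 2)
    (if i == 0 then (if j == 0 then a else b) else (if j == 0 then c else d)).

Definition D (t : circle R) : R :=
  ell ^+ 2 / J * sinS t ^+ 2 + 1 / m * cosS t ^+ 2.

Definition mx_f (t : circle R) : 'M[R]_2 :=
  mx2 (1 - 2 * ell ^+ 2 * sinS t ^+ 2 / (J * D t))
      (- (2 * ell * cosS t * sinS t / (m * D t)))
      (- (2 * ell * cosS t * sinS t / (J * D t)))
      (1 - 2 * cosS t ^+ 2 / (m * D t)).

Definition mx_b (t : circle R) : 'M[R]_2 :=
  mx2 (1 - 2 * ell ^+ 2 * sinS t ^+ 2 / (J * D t))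
      (2 * ell * cosS t * sinS t / (m * D t))
      (2 * ell * cosS t * sinS t / (J * D t))
      (1 - 2 * cosS t ^+ 2 / (m * D t)).

Definition set_velocities z (w : 'rV[R]_2) : state R :=
  State (phi z) (vth z) (w 0 0) (w 0 1).

Definition impact_map z : state R :=
  if z \in I_f_minus then
    set_velocities z (row2 (omega z) (vel z) *m mx_f (vth z))
  else
    set_velocities z (row2 (omega z) (vel z) *m mx_b (vth z)).

Definition T z : state R := impact_map (Ro z).

(* [theta] is a real-valued lift of the orientation. *)
Definition smooth_motion (w v : R) (theta : R -> R) (p : R -> R * R) : Prop :=
  forall t : R,
    [/\ is_derive t 1 theta w,
        is_derive t 1 (fun s => (p s).1) (v * cos (theta t)) &
        is_derive t 1 (fun s => (p s).2) (v * sin (theta t))].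

Definition on_impact_surface q : Prop := h q = Rad ^+ 2.

(* [pre_impact t z t' z'] : the smooth dynamics started at time [t] from the
   post-impact state [z] meets the impact surface for the first time after [t]
   at time [t'], in the pre-impact state [z']. *)
Definition pre_impact (t : R) z (t' : R) (z' : state R) : Prop :=
  exists theta : R -> R, exists p : R -> R * R,
    let q s := Config (angle (theta s)) (p s) in
    [/\ smooth_motion (omega z) (vel z) theta p,
        q t = config_of z,
        t < t',
        on_impact_surface (q t') /\
        (forall s, t < s < t' -> ~ on_impact_surface (q s)) &
        [/\ I_minus z', config_of z' = q t',
            omega z' = omega z & vel z' = vel z]].

Definition next_post_impact (t : R) z (t' : R) (z' : state R) : Prop :=
  exists2 zm : state R, pre_impact t z t' zm & z' = impact_map zm.

End Billiard.

(* Main.v *)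
Require Import Defs.
From HB Require Import structures.
From mathcomp Require Import all_boot all_order all_algebra.
From mathcomp Require Import all_classical all_reals all_analysis.
From mathcomp Require Import ring_quotient ring lra.
Import Order.TTheory GRing.Theory Num.Theory.
Import numFieldNormedType.Exports.

Set Implicit Arguments.
Unset Strict Implicit.
Unset Printing Implicit Defensive.

Local Open Scope ring_scope.

(** The contact point of an impact state is one end of the blade.  Writing
    [a = ell] when it is the front end and [a = - ell] when it is the back end,
    every formula of the front and back cases becomes the same formula in the
    signed lever [a] ([mid_of_lever], [N_lever], [impact_mapE]), the map [Ro]
    sends lever [a] to lever [- a], and the normal speed [N] changes sign under
    both [Ro] and the impact map ([Ro_lever], [impact_map_lever]).  This settles
    the domains and codomains of [Ro] and [T].

    For the dynamics, if [omega <> 0] the motion is a rotation about a fixed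
    centre [c], and both ends run on the same circle about [c], the end opposite
    to the contact being ahead of the contact end by an angle [2 e] in
    ]0, 2 pi[ in the direction of motion ([end_swap]).  The contact end starts
    at the table boundary, moving inwards or tangentially; along its circle the
    excess [|.|^2 - Rad^2] is a negative multiple of
    [sin (u / 2) * sin (f - u / 2)] in the angle of rotation [u]
    ([end_sq_chord]), so that within a turn it is inside the table
    exactly for [0 < u < 2 f].  The opposite end starts strictly inside, hence
    [e < f], and being ahead it is the first to leave, at [u = 2 (f - e)]
    ([first_return]).  It leaves at the other intersection of the two circles
    (at their point of tangency if there is only one), the mirror image of
    the initial contact in the line from the origin to [c]; the angle [alpha] of
    the definition of [Ro] is the angle at the origin between this line and the
    contact point ([Omega_rotation]).  If [omega = 0],
    the blade slides along its own line and leaves at the other end of the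
    chord ([flight_translation]).  So [Ro z] is a next pre-impact state.

    It is the only one: the equations of motion determine the configuration at
    all times ([smooth_motion_unique]), first hitting times agree, and a
    configuration with given velocities comes from at most one impact state
    ([config_of_inj]), because only one end can lie on the boundary. *)

(** * Trigonometry on the circle *)

Section Circle.
Context {R : realType}.
Implicit Types (x y : R) (a b : circle R).

Lemma angleD x y : angle (x + y) = angle x + angle y.
Proof. exact: (raddfD (\pi_(Quotient.quot (@two_pi_Z R)))%qT). Qed.

Lemma angleN x : angle (- x) = - angle x.
Proof. exact: (raddfN (\pi_(Quotient.quot (@two_pi_Z R)))%qT). Qed.

Lemma cosSD a b : cosS (a + b) = cosS a * cosS b - sinS a * sinS b.
Proof.
rewrite -(angle_repK a) -(angle_repK b) -angleD !cosS_angle !sinS_angle.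
exact: cosD.
Qed.

Lemma sinSD a b : sinS (a + b) = sinS a * cosS b + cosS a * sinS b.
Proof.
rewrite -(angle_repK a) -(angle_repK b) -angleD !cosS_angle !sinS_angle.
exact: sinD.
Qed.

Lemma cosSN a : cosS (- a) = cosS a.
Proof. by rewrite -(angle_repK a) -angleN !cosS_angle cosN. Qed.

Lemma sinSN a : sinS (- a) = - sinS a.
Proof. by rewrite -(angle_repK a) -angleN !sinS_angle sinN. Qed.

Lemma cos2Dsin2S a : cosS a ^+ 2 + sinS a ^+ 2 = 1.
Proof. exact: cos2Dsin2. Qed.

Lemma cosS_Dpi a : cosS (a + angle pi) = - cosS a.
Proof. by rewrite cosSD cosS_angle sinS_angle cospi sinpi; ring. Qed.

Lemma sinS_Dpi a : sinS (a + angle pi) = - sinS a.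
Proof. by rewrite sinSD cosS_angle sinS_angle cospi sinpi; ring. Qed.

Lemma angle_pi2 : angle (pi : R) + angle pi = 0.
Proof.
rewrite -angleD -[RHS](raddf0 (\pi_(Quotient.quot (@two_pi_Z R)))%qT).
by apply/angle_eq; exists 1; rewrite subr0 mulr1z mulr2n.
Qed.

Lemma cos_half x : cos x = 1 - 2 * sin (x / 2) ^+ 2.
Proof.
have {1}-> : x = (x / 2) *+ 2 by rewrite mulr2n; field.
by rewrite cos_mulr2n sin2cos2 mulr2n; ring.
Qed.

Lemma sin_half x : sin x = 2 * sin (x / 2) * cos (x / 2).
Proof.
have {1}-> : x = (x / 2) *+ 2 by rewrite mulr2n; field.
by rewrite sin_mulr2n mulr2n; ring.
Qed.

(** Modulo [2 pi] the angle may be taken in [0, 2 pi[, where the sine of its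
    half vanishes only at [0]. *)
Lemma cos_eq1_angle x : cos x = 1 -> angle x = 0.
Proof.
move=> cx1; pose P := (pi : R) *+ 2; pose k := Num.floor (x / P).
have P0 : 0 < P by rewrite mulrn_wgt0 // pi_gt0.
have /andP[kx xk] := floor_itv (x / P).
have {}kx : P *~ k <= x by rewrite -mulrzr -ler_pdivlMl// mulrC.
have {}xk : x - P *~ k < P.
  move: xk; rewrite intrD ltr_pdivrMr// mulrDl mul1r mulrzl -/k; lra.
have u0 : 0 <= x - P *~ k by rewrite subr_ge0.
have cu : cos (x - P *~ k) = 1.
  by rewrite -cx1 -(periodicz (@cosD2pi R) (- k) x) mulrNz.
rewrite -[RHS](raddf0 (\pi_(Quotient.quot (@two_pi_Z R)))%qT).
apply/angle_eq; exists k; rewrite subr0 -/P; apply/eqP; rewrite -subr_eq0.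
apply: contraT => u_neq0.
have : 0 < sin ((x - P *~ k) / 2).
  apply: sin_gt0_pi; apply/andP; split.
    by rewrite divr_gt0// lt0r u_neq0 u0.
  by move: xk; rewrite {2}/P mulr2n; lra.
by move: cu; rewrite cos_half; nra.
Qed.

Lemma circle_eq a b : cosS a = cosS b -> sinS a = sinS b -> a = b.
Proof.
move=> cab sab; apply/eqP; rewrite -subr_eq0 -(angle_repK (a - b)).
apply/eqP/cos_eq1_angle; rewrite -cosS_angle angle_repK cosSD cosSN sinSN.
by rewrite cab sab -(cos2Dsin2S b); ring.
Qed.

(** [acos] of the normalised abscissa is the polar angle of a point of the
    closed upper half plane. *)
Lemma acos_polar x y (r : R) : 0 <= y -> 0 < r -> r ^+ 2 = x ^+ 2 + y ^+ 2 ->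
  [/\ 0 <= acos (x / r) <= pi, cos (acos (x / r)) = x / r &
      sin (acos (x / r)) = y / r].
Proof.
move=> y0 r0 rE.
have r_neq0 : r != 0 by rewrite gt_eqF.
have E : 1 - (x / r) ^+ 2 = (y / r) ^+ 2.
  have -> : (y / r) ^+ 2 = (r ^+ 2 - x ^+ 2) / r ^+ 2.
    by rewrite expr_div_n rE; congr (_ / _); ring.
  by field.
have xr : -1 <= x / r <= 1.
  by rewrite ler_pdivlMr// ler_pdivrMr//; apply/andP; split; nra.
have [? ?] := acos_def xr; split => //.
by rewrite sin_acos// E sqrtr_sqr ger0_norm// divr_ge0// ltW.
Qed.

Lemma polar_upper_half x y : 0 <= y -> exists r e : R,
  [/\ 0 <= r, r ^+ 2 = x ^+ 2 + y ^+ 2, 0 <= e <= pi,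
      x = r * cos e & y = r * sin e].
Proof.
move=> y0; have xy0 : 0 <= x ^+ 2 + y ^+ 2 by rewrite addr_ge0 ?sqr_ge0.
have := sqrtr_ge0 (x ^+ 2 + y ^+ 2); have := sqr_sqrtr xy0.
move: (Num.sqrt _) => r rE; rewrite le_eqVlt => /orP[/eqP r0|r0].
  exists 0, 0; rewrite !mul0r lexx pi_ge0; split => //; first by rewrite -rE -r0.
    by apply/eqP; rewrite -sqrf_eq0; apply/eqP; move: rE; rewrite -r0; nra.
  by apply/eqP; rewrite -sqrf_eq0; apply/eqP; move: rE; rewrite -r0; nra.
have [e0 ce se] := acos_polar y0 r0 rE.
have r_neq0 : r != 0 by rewrite gt_eqF.
exists r, (acos (x / r)); rewrite ce se; split => //; first exact: ltW.
  by field.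
by field.
Qed.

End Circle.

(** * Impact states and the elastic impact *)

Section Contact.
Context {R : realType}.
Variables (Rad ell m J : R).
Hypotheses (Rad_gt0 : 0 < Rad) (ell_gt0 : 0 < ell).
Hypotheses (m_gt0 : 0 < m) (J_gt0 : 0 < J).
Implicit Types (z : state R) (a : R).

(** The signed distance [a] from the midpoint to the end in contact, positive
    along the orientation: [ell] for a front-type state and [- ell] for a
    back-type one.  Multiplying the condition on [cosS (vth z)] by [Rad * a]
    gives both types the same inequality. *)
Definition contact_lever z a : Prop :=
  [/\ nonrest z, a ^+ 2 = ell ^+ 2 & a ^+ 2 < Rad * a * cosS (vth z)].

Definition normal_speed z a : R :=
  vel z * cosS (vth z) + a * omega z * sinS (vth z).

Lemma lever_cases z a : contact_lever z a ->
  (a = ell /\ impact_f Rad ell z) \/ (a = - ell /\ impact_b Rad ell z).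
Proof.
move=> [nz /eqP + aC]; rewrite eqf_sqr => /orP[] /eqP aE;
  rewrite aE in aC *; [left|right].
  by do 2!split=> //; rewrite ltr_pdivrMr// -(ltr_pM2l ell_gt0); lra.
by do 2!split=> //; rewrite ltr_pdivrMr// -(ltr_pM2l ell_gt0); lra.
Qed.

Lemma impact_lever z : impact Rad ell z <-> exists a, contact_lever z a.
Proof.
split=> [[[nz]|[nz]]|[a /lever_cases[][_ ?]]].
- by rewrite ltr_pdivrMr// -(ltr_pM2l ell_gt0) => lC; exists ell; split=> //; lra.
- rewrite ltr_pdivrMr// -(ltr_pM2l ell_gt0) => lC.
  by exists (- ell); split=> //; rewrite ?sqrrN//; lra.
- by left.
- by right.
Qed.

Lemma front_back_disjoint z :
  impact_b Rad ell z -> (z \in impact_f Rad ell) = false.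
Proof.
move=> [_ lb]; apply/negbTE/negP; rewrite in_setE => -[_ lf].
have : 0 < ell / Rad by rewrite divr_gt0.
lra.
Qed.

Lemma mid_of_lever z a : contact_lever z a ->
  mid_of Rad ell z = scale2 Rad (dir (phi z)) - scale2 a (dir (theta_of z)).
Proof.
move=> /lever_cases[][-> i]; rewrite /mid_of; first by rewrite mem_set.
rewrite front_back_disjoint// /scale2 /= !mulNr.
by congr pair => /=; rewrite opprK.
Qed.

Lemma N_lever z a : contact_lever z a -> N Rad ell z = normal_speed z a.
Proof.
move=> /lever_cases[][-> i]; rewrite /N /normal_speed.
  by rewrite mem_set// addrC.
by rewrite front_back_disjoint// !mulNr.
Qed.

Lemma I_plusP z : I_plus Rad ell z <->
  exists2 a, contact_lever z a & normal_speed z a <= 0.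
Proof.
split=> [[|] [/impact_lever[a az]]|[a az]].
- by rewrite (N_lever az) => /ltW; exists a.
- by rewrite (N_lever az) => N0; exists a => //; rewrite N0.
- rewrite -(N_lever az) le_eqVlt => /orP[/eqP|] ?; [right|left];
  by split=> //; apply/impact_lever; exists a.
Qed.

Lemma I_minusP z : I_minus Rad ell z <->
  exists2 a, contact_lever z a & 0 <= normal_speed z a.
Proof.
split=> [[|] [/impact_lever[a az]]|[a az]].
- by rewrite (N_lever az) => /ltW; exists a.
- by rewrite (N_lever az) => N0; exists a => //; rewrite N0.
- rewrite -(N_lever az) le_eqVlt => /orP[/eqP|] ?; [right|left];
  by split=> //; apply/impact_lever; exists a.
Qed.

Lemma lever_neq0 z a : contact_lever z a -> a != 0.
Proof.
by move=> [_ _]; apply: contraTneq => ->; rewrite expr0n mulr0 mul0r ltxx.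
Qed.

Lemma D_gt0 (t : circle R) : 0 < D ell m J t.
Proof.
have c0 := sqr_ge0 (cosS t); have s0 := sqr_ge0 (sinS t).
have l0 : 0 < ell ^+ 2 / J by rewrite divr_gt0// exprn_gt0.
have m0 : 0 < 1 / m by rewrite divr_gt0.
have := cos2Dsin2S t; rewrite /D.
move: s0; rewrite le_eqVlt => /orP[/eqP <-|s0 _].
  by rewrite addr0 => ->; rewrite mulr0 add0r mulr1.
by apply: (ltr_wpDr (mulr_ge0 (ltW m0) c0)); exact: mulr_gt0.
Qed.

(** Both impact matrices are the identity minus a rank-one matrix: they
    subtract from the velocities a multiple of the normal speed. *)
Lemma impact_mapE z a (D := D ell m J (vth z)) :
  contact_lever z a -> 0 <= normal_speed z a ->
  impact_map Rad ell m J z = State (phi z) (vth z)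
    (omega z - 2 * normal_speed z a * a * sinS (vth z) / (J * D))
    (vel z - 2 * normal_speed z a * cosS (vth z) / (m * D)).
Proof.
move=> az Nz; have D0 : D != 0 by rewrite gt_eqF// D_gt0.
have m0 : m != 0 by rewrite gt_eqF.
have J0 : J != 0 by rewrite gt_eqF.
have zI : I_minus Rad ell z by apply/I_minusP; exists a.
rewrite /impact_map /set_velocities.
have [[aE zf]|[aE zb]] := lever_cases az.
  have -> : z \in I_f_minus Rad ell by rewrite in_setE.
  rewrite !mxE !big_ord_recl !big_ord0 !mxE /= -/D aE /normal_speed.
  by congr State; field; rewrite D0 ?m0 ?J0.
have -> : (z \in I_f_minus Rad ell) = false.
  apply/negbTE/negP; rewrite in_setE => -[_ zf].
  by move: (front_back_disjoint zb); rewrite mem_set.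
rewrite !mxE !big_ord_recl !big_ord0 !mxE /= -/D aE /normal_speed.
by congr State; field; rewrite D0 ?m0 ?J0.
Qed.

(** The impact reverses the normal speed.  The new velocities cannot both
    vanish: the normal speed would then be [0], and the impact would have left
    the nonzero incoming velocities unchanged. *)
Lemma impact_map_lever z a : contact_lever z a -> 0 <= normal_speed z a ->
  contact_lever (impact_map Rad ell m J z) a /\
  normal_speed (impact_map Rad ell m J z) a = - normal_speed z a.
Proof.
move=> az Nz; have D0 := D_gt0 (vth z).
have m0 : m != 0 by rewrite gt_eqF.
have J0 : J != 0 by rewrite gt_eqF.
have [nz a2 aC] := az.
have NE : normal_speed (impact_map Rad ell m J z) a = - normal_speed z a.
  rewrite (impact_mapE az Nz) /normal_speed /=.
  have : m * a ^+ 2 * sinS (vth z) ^+ 2 + J * cosS (vth z) ^+ 2 =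
      m * J * D ell m J (vth z).
    by rewrite a2 /D; field; rewrite m0 J0.
  move: D0; move: (D _ _ _ _) (sinS _) (cosS _) => E S C E0 EE.
  have -> : E = (m * a ^+ 2 * S ^+ 2 + J * C ^+ 2) / (m * J).
    by rewrite EE; field; rewrite m0 J0.
  by field; rewrite m0 J0 /= EE !mulf_neq0// gt_eqF.
split=> //; rewrite (impact_mapE az Nz) in NE *; split=> //= -[w0 v0].
rewrite {1}/normal_speed /= in NE.
move: NE; rewrite w0 v0 mulr0 !mul0r addr0 => /eqP.
rewrite eq_sym oppr_eq0 => /eqP N0.
by apply: nz; move: w0 v0; rewrite N0 !(mulr0, mul0r) !subr0 => -> ->.
Qed.

Lemma Ro_lever z a : contact_lever z a ->
  contact_lever (Ro Rad ell z) (- a) /\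
  normal_speed (Ro Rad ell z) (- a) = - normal_speed z a.
Proof.
move=> [nz a2 aC]; split; last first.
  by rewrite /normal_speed /= cosS_Dpi sinS_Dpi cosSN sinSN; ring.
split=> //=; first by rewrite sqrrN.
by rewrite sqrrN cosS_Dpi cosSN; move: aC; nra.
Qed.

End Contact.

(** * Configurations on the impact surface *)

Section Surface.
Context {R : realType}.
Variables (Rad ell : R).
Hypotheses (Rad_gt0 : 0 < Rad) (ell_gt0 : 0 < ell).
Implicit Types (z : state R) (a b : R) (q : config R).

Definition blade_end q b : R * R := midpt q + scale2 b (dir (orient q)).

Lemma h_blade_end q a : a ^+ 2 = ell ^+ 2 ->
  h ell q = Num.max (sqnorm2 (blade_end q a)) (sqnorm2 (blade_end q (- a))).
Proof.
have backE : back_pt ell q = blade_end q (- ell).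
  by rewrite /back_pt /blade_end /scale2 !mulNr.
move=> /eqP; rewrite eqf_sqr => /orP[] /eqP ->; rewrite /h backE//.
by rewrite opprK maxC.
Qed.

Lemma contact_end z a : contact_lever Rad ell z a ->
  blade_end (config_of Rad ell z) a = scale2 Rad (dir (phi z)).
Proof.
by move=> az; rewrite /blade_end /= (mid_of_lever Rad_gt0 ell_gt0 az) subrK.
Qed.

Lemma sqnorm_scale_dir b (t : circle R) : sqnorm2 (scale2 b (dir t)) = b ^+ 2.
Proof.
by rewrite /sqnorm2 /= !exprMn -mulrDr cos2Dsin2S mulr1.
Qed.

(** With the contact end at distance [Rad] from the origin, the square distance
    of the other end is [Rad ^ 2 - 4 * (Rad * a * cosS (vth z) - a ^ 2)]; the
    condition on the angle of an impact state is exactly that the other end is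
    inside. *)
Lemma sqnorm_far_end z a : contact_lever Rad ell z a ->
  sqnorm2 (blade_end (config_of Rad ell z) (- a)) < Rad ^+ 2.
Proof.
move=> az; have [_ _ aC] := az.
rewrite /blade_end /sqnorm2 /= (mid_of_lever Rad_gt0 ell_gt0 az) /= /theta_of.
rewrite cosSD sinSD cosSN sinSN.
have := cos2Dsin2S (phi z); have := cos2Dsin2S (vth z).
move: aC; move: (cosS _) (sinS _) (cosS _) (sinS _) => c s C S aC CS cs.
set l := (X in X < _).
suff -> : l = Rad ^+ 2 - 4 * (Rad * a * C - a ^+ 2) by lra.
have -> : l = Rad ^+ 2 * (c ^+ 2 + s ^+ 2) -
    4 * (Rad * a * C * (c ^+ 2 + s ^+ 2)
      - a ^+ 2 * ((C ^+ 2 + S ^+ 2) * (c ^+ 2 + s ^+ 2))) by rewrite /l; ring.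
by rewrite CS cs; ring.
Qed.

Lemma impact_on_surface z : impact Rad ell z ->
  on_impact_surface Rad ell (config_of Rad ell z).
Proof.
move=> /(impact_lever Rad_gt0 ell_gt0)[a az]; have [_ a2 _] := az.
rewrite /on_impact_surface (h_blade_end _ a2) (contact_end az) sqnorm_scale_dir.
by apply: max_l; rewrite ltW// sqnorm_far_end.
Qed.

(** The configuration shows which end is in contact, as the other one is
    strictly inside the table; the contact point then gives [phi], and the
    orientation gives [vth]. *)
Lemma config_of_inj z1 z2 : impact Rad ell z1 -> impact Rad ell z2 ->
  config_of Rad ell z1 = config_of Rad ell z2 ->
  omega z1 = omega z2 -> vel z1 = vel z2 -> z1 = z2.
Proof.
move=> /(impact_lever Rad_gt0 ell_gt0)[a1 az1].
move=> /(impact_lever Rad_gt0 ell_gt0)[a2 az2] qE.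
have a12 : a1 = a2.
  have [_ a1E _] := az1; have [_ a2E _] := az2.
  have /eqP := etrans a1E (esym a2E); rewrite eqf_sqr => /orP[/eqP //|/eqP aN].
  have := sqnorm_far_end az1.
  by rewrite aN opprK qE (contact_end az2) sqnorm_scale_dir ltxx.
rewrite -{}a12 in az2.
have [th _] : theta_of z1 = theta_of z2 /\ mid_of Rad ell z1 = mid_of Rad ell z2.
  by case: qE.
have : scale2 Rad (dir (phi z1)) = scale2 Rad (dir (phi z2)).
  by rewrite -(contact_end az1) -(contact_end az2) qE.
have Rad0 : Rad != 0 by rewrite gt_eqF.
move=> [/(mulfI Rad0) c /(mulfI Rad0) s].
have p12 : phi z1 = phi z2 by apply: circle_eq.
move: th; rewrite /theta_of p12 => /addrI/oppr_inj v12.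
by case: z1 z2 p12 v12 {az1 az2 qE c s} => ? ? ? ? [? ? ? ?] /= -> -> -> ->.
Qed.

End Surface.

(** * The smooth motion *)

Section Motion.
Context {R : realType}.
Implicit Types (w v t : R) (theta : R -> R) (p : R -> R * R).

Lemma derive_eq_cst (f g df : R -> R) t s :
  (forall x : R, is_derive x 1 f (df x)) ->
  (forall x : R, is_derive x 1 g (df x)) ->
  f s - g s = f t - g t.
Proof.
move=> fd gd; apply: (@is_derive_0_is_cst _ (f - g) s t) => x.
by rewrite -(subrr (df x)); exact: is_deriveB.
Qed.

(** Two lifts of the orientation differ by a constant multiple of [2 pi], so the
    midpoints have the same derivative. *)
Lemma smooth_motion_unique w v theta1 p1 theta2 p2 t :
  smooth_motion w v theta1 p1 -> smooth_motion w v theta2 p2 ->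
  angle (theta1 t) = angle (theta2 t) -> p1 t = p2 t ->
  forall s, angle (theta1 s) = angle (theta2 s) /\ p1 s = p2 s.
Proof.
move=> m1 m2 th12 p12.
have thE s : angle (theta1 s) = angle (theta2 s).
  apply/eqP; rewrite -subr_eq0 -angleN -angleD.
  have -> : theta1 s - theta2 s = theta1 t - theta2 t.
    by apply: (@derive_eq_cst _ _ (fun=> w)) => x; [case: (m1 x)|case: (m2 x)].
  by rewrite angleD angleN th12 subrr.
move=> s; split => //.
have cE x : cos (theta1 x) = cos (theta2 x) by rewrite -!cosS_angle thE.
have sE x : sin (theta1 x) = sin (theta2 x) by rewrite -!sinS_angle thE.
have e1 : (p1 s).1 - (p2 s).1 = (p1 t).1 - (p2 t).1.
  apply: (@derive_eq_cst (fun s => (p1 s).1) (fun s => (p2 s).1)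
           (fun x => v * cos (theta1 x))) => x; first by case: (m1 x).
  by rewrite cE; case: (m2 x).
have e2 : (p1 s).2 - (p2 s).2 = (p1 t).2 - (p2 t).2.
  apply: (@derive_eq_cst (fun s => (p1 s).2) (fun s => (p2 s).2)
           (fun x => v * sin (theta1 x))) => x; first by case: (m1 x).
  by rewrite sE; case: (m2 x).
move: e1 e2; rewrite p12 !subrr; case: (p1 s) (p2 s) => [? ?] [? ?] /=.
by move=> /eqP + /eqP; rewrite !subr_eq0 => /eqP -> /eqP ->.
Qed.

Lemma is_derive_affine (w c t x : R) :
  is_derive x 1 (fun s : R => c + w * (s - t)) w.
Proof.
have -> : (fun s : R => c + w * (s - t)) = cst (c - w * t) + w \*: (@id R).
  by apply/funext => s; rewrite fctE /= /GRing.scale /=; ring.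
by apply: is_derive_eq; rewrite add0r /GRing.scale /= mulr1.
Qed.

Lemma smooth_motion_translation v (theta0 : R) (p0 : R * R) t :
  smooth_motion 0 v (fun=> theta0)
    (fun s => (p0.1 + v * (s - t) * cos theta0, p0.2 + v * (s - t) * sin theta0)).
Proof.
move=> x; split; first exact: is_derive_cst.
  rewrite (_ : (fun _ => _) = (fun s => p0.1 + v * cos theta0 * (s - t))).
    exact: is_derive_affine.
  by apply/funext => s /=; ring.
rewrite (_ : (fun _ => _) = (fun s => p0.2 + v * sin theta0 * (s - t))).
  exact: is_derive_affine.
by apply/funext => s /=; ring.
Qed.

Lemma smooth_motion_rotation w v (theta0 : R) (p0 : R * R) t : w != 0 ->
  let theta s := theta0 + w * (s - t) in
  smooth_motion w v theta
    (fun s => (p0.1 + v / w * (sin (theta s) - sin theta0),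
               p0.2 + v / w * (cos theta0 - cos (theta s)))).
Proof.
move=> w0 theta x.
have dth (y : R) : is_derive y 1 theta w by exact: is_derive_affine.
have ds := is_derive1_comp (is_derive_sin (theta x)) (dth x).
have dc := is_derive1_comp (is_derive_cos (theta x)) (dth x).
split; first exact: dth.
  rewrite (_ : (fun _ => _) =
     cst (p0.1 - v / w * sin theta0) + (v / w) \*: (sin \o theta)).
    by apply: is_derive_eq; rewrite add0r /GRing.scale /=; field.
  by apply/funext => s; rewrite fctE /= /GRing.scale /=; ring.
rewrite (_ : (fun _ => _) =
     cst (p0.2 + v / w * cos theta0) + (- (v / w)) \*: (cos \o theta)).
  by apply: is_derive_eq; rewrite add0r /GRing.scale /=; field.
by apply/funext => s; rewrite fctE /= /GRing.scale /=; ring.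
Qed.

End Motion.

(** * A blade rotating about a fixed centre *)

Section RotatingBlade.
Context {R : realType}.
Implicit Types (x y k a b u : R).

(** Square distance to the origin of the end at lever [b] of a blade turned by
    the angle [u] about the centre [(x, y)].  In complex notation the end is
    [x + i y + exp (i u) * (b - i k)]: at [u = 0] the blade is horizontal and
    [k] is the signed distance from its line to the centre. *)
Definition end_sq x y k b u : R :=
  (x + b * cos u + k * sin u) ^+ 2 + (y + b * sin u - k * cos u) ^+ 2.

(** The square distance is a sinusoid in [u], so the difference of two of its
    values is a product of two sines.  The zeros are the instants at which the
    end is back at its initial distance: a full turn, or [u = 2 f], when it
    reaches the other intersection of its circle with the circle about the
    origin. *)
Lemma end_sq_chord x y k a r f u :
  k * y - x * a = r * cos f -> - (y * a + x * k) = r * sin f ->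
  end_sq x y k a u - end_sq x y k a 0 =
  - (4 * r * sin (u / 2) * sin (f - u / 2)).
Proof.
move=> cf sf.
have -> : - (4 * r * sin (u / 2) * sin (f - u / 2)) =
  - (4 * sin (u / 2) * (- (y * a + x * k) * cos (u / 2) -
     (k * y - x * a) * sin (u / 2))).
  by rewrite sinB cf sf; ring.
have -> : end_sq x y k a u - end_sq x y k a 0 =
  2 * ((x * a - k * y) * (cos u - 1) + (y * a + x * k) * sin u) +
  (a ^+ 2 + k ^+ 2) * (cos u ^+ 2 + sin u ^+ 2 - 1).
  by rewrite /end_sq cos0 sin0; ring.
rewrite cos2Dsin2 subrr [cos u]cos_half [sin u]sin_half; ring.
Qed.

(** Both ends lie on one circle about the centre, at an angle [2 e]: indeed
    [(- a - i k) / (a - i k)] is the square of the unit complex number in the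
    direction of [i (a + i k)].  Multiplying the latter by [a] puts it in the
    upper half plane for both signs of [a], which is why [e] is in ]0, pi[. *)
Lemma end_swap x y k a : a != 0 -> exists r e : R,
  [/\ 0 < r, r ^+ 2 = a ^+ 2 * (a ^+ 2 + k ^+ 2), 0 < e < pi,
      - (k * a) = r * cos e /\ a ^+ 2 = r * sin e &
      forall u, end_sq x y k (- a) u = end_sq x y k a (u + e *+ 2)].
Proof.
move=> a0; have a2 : 0 < a ^+ 2 by rewrite exprn_even_gt0.
have [r [e [r0 rE /andP[e0 epi] ce se]]] := polar_upper_half (- (k * a)) (ltW a2).
have rE' : r ^+ 2 = a ^+ 2 * (a ^+ 2 + k ^+ 2) by rewrite rE; ring.
have rpos : 0 < r.
  rewrite lt0r r0 andbT; apply: contraTneq a2 => r00.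
  by rewrite se r00 mul0r ltxx.
have spos : 0 < sin e by rewrite -(pmulr_rgt0 _ rpos) -se.
exists r, e; split=> //.
  apply/andP; split; rewrite lt_neqAle ?e0 ?epi andbT.
    by apply: contraTneq spos => <-; rewrite sin0 ltxx.
  by apply: contraTneq spos => ->; rewrite sinpi ltxx.
move=> u.
have r2 : r ^+ 2 != 0 by rewrite expf_neq0 ?gt_eqF.
have ak : a ^+ 2 + k ^+ 2 != 0.
  by move: r2; rewrite rE' mulf_eq0 negb_or => /andP[].
have cE : cos e = - (k * a) / r by rewrite ce; field; rewrite gt_eqF.
have sE : sin e = a ^+ 2 / r by rewrite se; field; rewrite gt_eqF.
have c2 : cos (e *+ 2) = (k ^+ 2 - a ^+ 2) / (a ^+ 2 + k ^+ 2).
  rewrite cos_mulr2n cE expr_div_n rE' mulr2n; field.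
  by rewrite a0 ak.
have s2 : sin (e *+ 2) = - 2 * k * a / (a ^+ 2 + k ^+ 2).
  rewrite sin_mulr2n cE sE mulf_div -expr2 rE' mulr2n; field.
  by rewrite a0 ak.
rewrite /end_sq cosD sinD c2 s2; congr (_ ^+ 2 + _ ^+ 2); by field; rewrite ak.
Qed.

(** The end [a] starts at square distance [R2], not moving outwards by the
    second hypothesis, and the first one says that the end [- a] starts closer
    to the origin.  The end [a] is below [R2] exactly up to the angle [2 f], and
    the end [- a] is ahead of it by [2 e], so the first return to [R2] is that
    of the end [- a], at [2 (f - e)].  The values of [cos u1] and [sin u1] say
    that [exp (i u1)] is [- (c / |c|) ^ 2] for [c = x + i y]: that instant is
    the mirror image of the initial one in the line through the origin and the
    centre. *)
Lemma first_return x y k a (R2 := end_sq x y k a 0) :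
    0 < x * a -> y * a + x * k <= 0 -> exists u1 : R,
  [/\ 0 < u1,
      forall u, 0 < u < u1 -> end_sq x y k a u < R2 /\ end_sq x y k (- a) u < R2,
      cos u1 = (y ^+ 2 - x ^+ 2) / (x ^+ 2 + y ^+ 2) &
      sin u1 = - (2 * x * y) / (x ^+ 2 + y ^+ 2)].
Proof.
move=> xa0 yaxk; have a0 : a != 0.
  by apply: contraTneq xa0 => ->; rewrite mulr0 ltxx.
have x0 : x != 0 by apply: contraTneq xa0 => ->; rewrite mul0r ltxx.
have x2 : 0 < x ^+ 2 by rewrite exprn_even_gt0.
have y2 : 0 <= y ^+ 2 by rewrite sqr_ge0.
have [r [e [r0 rE /andP[e0 epi] [ce se] swap]]] := end_swap x y k a0.
have spos : 0 <= - (y * a + x * k) by rewrite oppr_ge0.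
have [q [f [q0 qE /andP[f0 fpi] cf sf]]] := polar_upper_half (k * y - x * a) spos.
have chord := end_sq_chord _ cf sf.
have se0 : 0 < sin e by apply: sin_gt0_pi; rewrite e0.
have half (z : R) : z *+ 2 / 2 = z by rewrite mulr2n; field.
(* The end [- a] starts below [R2], and it starts where the end [a] will be
   after an angle [2 e]. *)
have /andP[q1 sfe] : (0 < q) && (0 < sin (f - e)).
  have : end_sq x y k (- a) 0 - R2 < 0.
    have -> : end_sq x y k (- a) 0 - R2 = - (4 * (x * a)).
      by rewrite /R2 /end_sq cos0 sin0; ring.
    lra.
  rewrite swap add0r chord half oppr_lt0 -!mulrA pmulr_rgt0//.
  move: q0; rewrite le_eqVlt => /orP[/eqP <-|q1]; first by rewrite mul0r ltxx.
  by rewrite q1 pmulr_rgt0// pmulr_rgt0.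
have fe : e < f.
  rewrite ltNge; apply/negP => fe.
  move: fe; rewrite le_eqVlt => /orP[/eqP fe|fe].
    by move: sfe; rewrite fe subrr sin0 ltxx.
  have : 0 < sin (e - f) by apply: sin_gt0_pi; lra.
  by rewrite -opprB sinN; lra.
have inside u : 0 < u / 2 < f -> end_sq x y k a u < R2.
  move=> /andP[u0 uf]; rewrite -subr_lt0 chord oppr_lt0.
  by rewrite !mulr_gt0 ?ltr0n//; apply: sin_gt0_pi; apply/andP; split; lra.
have q_neq0 : q != 0 by rewrite gt_eqF.
have r_neq0 : r != 0 by rewrite gt_eqF.
have qr2 : (q * r) ^+ 2 = (x ^+ 2 + y ^+ 2) * (a ^+ 2 + k ^+ 2) ^+ 2 * a ^+ 2.
  by rewrite exprMn qE rE; ring.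
have cE : cos (f - e) = - (y * a * (a ^+ 2 + k ^+ 2)) / (q * r).
  have -> : - (y * a * (a ^+ 2 + k ^+ 2)) =
    (k * y - x * a) * - (k * a) + - (y * a + x * k) * a ^+ 2 by ring.
  by rewrite cf sf ce se cosB; field; rewrite q_neq0 r_neq0.
have sE : sin (f - e) = x * a * (a ^+ 2 + k ^+ 2) / (q * r).
  have -> : x * a * (a ^+ 2 + k ^+ 2) =
    - (y * a + x * k) * - (k * a) - (k * y - x * a) * a ^+ 2 by ring.
  by rewrite cf sf ce se sinB; field; rewrite q_neq0 r_neq0.
have a2 : 0 < a ^+ 2 by rewrite exprn_even_gt0.
have k2 : 0 <= k ^+ 2 by rewrite sqr_ge0.
exists ((f - e) *+ 2); split.
- by rewrite mulrn_wgt0// subr_gt0.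
- move=> u /andP[u0 u1]; rewrite swap.
  split; apply: inside; move: u1; rewrite ?(mulr2n e) (mulr2n (f - e)) => u1;
    by apply/andP; split; lra.
- rewrite cos_mulr2n cE expr_div_n qr2 mulr2n; field.
  by rewrite a0 !gt_eqF ?ltr_wpDr.
- rewrite sin_mulr2n cE sE mulf_div -expr2 qr2 mulr2n; field.
  by rewrite a0 !gt_eqF ?ltr_wpDr.
Qed.

End RotatingBlade.

(** * From one impact to the next *)

(** Everything is computed in the frame turned by the initial orientation.
    There the midpoint starts at [(x, Rad * S)], and for [omega z <> 0] the
    centre of rotation is [(x, y)]. *)
Section Flight.
Context {R : realType}.
Variables (Rad ell : R).
Hypotheses (Rad_gt0 : 0 < Rad) (ell_gt0 : 0 < ell).
Variables (z : state R) (a : R).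
Hypotheses (az : contact_lever Rad ell z a) (Nz : normal_speed z a <= 0).

Local Notation C := (cosS (vth z)).
Local Notation S := (sinS (vth z)).
Local Notation k := (vel z / omega z).
Local Notation x := (Rad * C - a).
Local Notation y := (Rad * S + k).
Local Notation z' := (Ro Rad ell z).

Lemma phi_theta : phi z = theta_of z + vth z.
Proof. by rewrite /theta_of subrK. Qed.

Lemma mid_of_frame : mid_of Rad ell z =
  (cosS (theta_of z) * x - sinS (theta_of z) * (Rad * S),
   sinS (theta_of z) * x + cosS (theta_of z) * (Rad * S)).
Proof.
rewrite (mid_of_lever Rad_gt0 ell_gt0 az) phi_theta /scale2 /dir cosSD sinSD.
by congr pair => /=; ring.
Qed.

(** The summand in parentheses is the angle by which the blade has to turn
    during the flight. *)
Lemma theta_of_Ro :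
  theta_of z' = theta_of z + (Omega Rad ell z + vth z *+ 2 + angle pi).
Proof.
have piN : - angle pi = angle pi :> circle R.
  by apply/eqP; rewrite eq_sym -addr_eq0 angle_pi2.
rewrite /theta_of /= opprD opprK piN mulr2n !addrA; congr (_ + _).
by rewrite [phi z - _ + _]addrAC subrK.
Qed.

Lemma mid_of_Ro : mid_of Rad ell z' =
  (- (x * cosS (theta_of z') + Rad * S * sinS (theta_of z')),
   Rad * S * cosS (theta_of z') - x * sinS (theta_of z')).
Proof.
have [az' _] := Ro_lever az; rewrite (mid_of_lever Rad_gt0 ell_gt0 az').
have -> : phi z' = theta_of z' + vth z'.
  by rewrite /theta_of subrK.
rewrite /scale2 /dir cosSD sinSD [vth z']/= cosS_Dpi sinS_Dpi cosSN sinSN.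
by congr pair => /=; ring.
Qed.

Lemma xa_gt0 : 0 < x * a.
Proof. by have [_ _ aC] := az; rewrite mulrBl -expr2; lra. Qed.

Lemma x_neq0 : x != 0.
Proof. by apply: contraTneq xa_gt0 => ->; rewrite mul0r ltxx. Qed.

Lemma sqr_dist_gt0 : 0 < x ^+ 2 + y ^+ 2.
Proof. by rewrite ltr_wpDr ?sqr_ge0// exprn_even_gt0// x_neq0. Qed.

Lemma rot_distE : rot_dist Rad ell z ^+ 2 = x ^+ 2 + y ^+ 2.
Proof.
rewrite /rot_dist /norm2 sqr_sqrtr; last by rewrite addr_ge0 ?sqr_ge0.
rewrite /rot_center mid_of_frame /sqnorm2 /=.
have := cos2Dsin2S (theta_of z); move: (cosS (theta_of z)) (sinS (theta_of z)).
move=> c s cs; rewrite -[RHS]mul1r -cs; ring.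
Qed.

(** Let [P = Rad * (C + i S)] be the contact point and [c = x + i y] the centre.
    Then [X + i Y] is [conj P * c], of modulus [Rad * rot_dist], and the law of
    cosines makes [alpha] its argument up to sign; since the state is
    post-impact, [omega * Y <= 0].  Hence [exp (i Omega)] is
    the square of the unit vector of [conj P * c], and multiplying by
    [(C + i S) ^ 2] leaves that of [c]. *)
Lemma Omega_rotation : omega z != 0 ->
  cosS (Omega Rad ell z + vth z *+ 2) = (x ^+ 2 - y ^+ 2) / (x ^+ 2 + y ^+ 2) /\
  sinS (Omega Rad ell z + vth z *+ 2) = 2 * x * y / (x ^+ 2 + y ^+ 2).
Proof.
move=> w0; have [_ a2 _] := az.
have OE : Omega Rad ell z = angle (- 2 * Num.sg (omega z) * alpha Rad ell z).
  rewrite /Omega memNset// => -[_ /eqP]; exact/negP.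
have g2 : Num.sg (omega z) ^+ 2 = 1 by rewrite sqr_sg w0.
pose X := Rad * (C * x + S * y); pose Y := Rad * (C * k + S * a).
have d2 := rot_distE; have d0 := sqr_dist_gt0; have CS := cos2Dsin2S (vth z).
have dpos : 0 < rot_dist Rad ell z.
  rewrite lt0r sqrtr_ge0 andbT; apply: contraTneq d0 => d00.
  by rewrite -d2 d00 expr0n ltxx.
have d_neq0 : rot_dist Rad ell z != 0 by rewrite gt_eqF.
have R_neq0 : Rad != 0 by rewrite gt_eqF.
have Y0 : 0 <= - (Num.sg (omega z) * Y).
  have -> : - (Num.sg (omega z) * Y) =
      Rad * `|omega z| / omega z ^+ 2 * - normal_speed z a.
    by rewrite normrEsg /Y /normal_speed; field.
  by rewrite mulr_ge0 ?oppr_ge0// mulr_ge0 ?invr_ge0 ?sqr_ge0// mulr_ge0// ltW.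
have XY : (rot_dist Rad ell z * Rad) ^+ 2 =
    X ^+ 2 + (- (Num.sg (omega z) * Y)) ^+ 2.
  rewrite exprMn d2 sqrrN (exprMn _ (Num.sg _)) g2 mul1r.
  have -> : Y = Rad * (C * y - S * x) by rewrite /Y; ring.
  by rewrite -[LHS]mulr1 -CS /X; ring.
have [_ ca sa] := acos_polar Y0 (mulr_gt0 dpos Rad_gt0) XY.
have aE : alpha Rad ell z = acos (X / (rot_dist Rad ell z * Rad)).
  have r2 : rot_radius ell z ^+ 2 = k ^+ 2 + ell ^+ 2.
    by rewrite sqr_sqrtr// addr_ge0 ?sqr_ge0.
  rewrite /alpha r2; congr acos.
  have -> : rot_dist Rad ell z ^+ 2 + Rad ^+ 2 - (k ^+ 2 + ell ^+ 2) = 2 * X.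
    have R2 : Rad ^+ 2 = Rad ^+ 2 * (C ^+ 2 + S ^+ 2) by rewrite CS mulr1.
    by rewrite d2 -a2 /X [Rad ^+ 2]R2; ring.
  by field; rewrite d_neq0 R_neq0.
have twice : - 2 * Num.sg (omega z) * alpha Rad ell z =
    - (Num.sg (omega z) * (alpha Rad ell z *+ 2)) by rewrite mulr2n; ring.
have cO : cosS (Omega Rad ell z) =
    (X ^+ 2 - Y ^+ 2) / (Rad ^+ 2 * (x ^+ 2 + y ^+ 2)).
  rewrite OE twice cosS_angle cosN cos_sg// cos_mulr2n aE ca.
  rewrite -d2 mulr2n; have -> : Y ^+ 2 = (rot_dist Rad ell z * Rad) ^+ 2 - X ^+ 2.
    by rewrite XY sqrrN (exprMn _ (Num.sg _)) g2; ring.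
  by field; rewrite d_neq0 R_neq0.
have sO : sinS (Omega Rad ell z) =
    2 * X * Y / (Rad ^+ 2 * (x ^+ 2 + y ^+ 2)).
  rewrite OE twice sinS_angle sinN sin_sg sin_mulr2n aE ca sa -d2 mulr2n.
  by rewrite -[RHS]mul1r -[X in _ = X * _]g2; field; rewrite d_neq0 R_neq0.
have XYx : X * C - Y * S = Rad * x.
  by rewrite -[RHS]mulr1 -CS /X /Y; ring.
have XYy : X * S + Y * C = Rad * y.
  by rewrite -[RHS]mulr1 -CS /X /Y; ring.
have xy0 : x ^+ 2 + y ^+ 2 != 0 by rewrite gt_eqF.
rewrite mulr2n !(cosSD, sinSD) cO sO; split.
  have -> : (x ^+ 2 - y ^+ 2) / (x ^+ 2 + y ^+ 2) =
    ((Rad * x) ^+ 2 - (Rad * y) ^+ 2) / (Rad ^+ 2 * (x ^+ 2 + y ^+ 2)).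
    by move: xy0; move: x y => X1 Y1 E0; field; rewrite R_neq0 E0.
  rewrite -XYx -XYy; move: (X) (Y) xy0; move: (x ^+ 2 + y ^+ 2) => E X1 Y1 E0.
  by field; rewrite R_neq0 E0.
have -> : 2 * x * y / (x ^+ 2 + y ^+ 2) =
    2 * (Rad * x) * (Rad * y) / (Rad ^+ 2 * (x ^+ 2 + y ^+ 2)).
  by move: xy0; move: x y => X1 Y1 E0; field; rewrite R_neq0 E0.
rewrite -XYx -XYy; move: (X) (Y) xy0; move: (x ^+ 2 + y ^+ 2) => E X1 Y1 E0.
by field; rewrite R_neq0 E0.
Qed.

Lemma impact_Ro : impact Rad ell z'.
Proof.
by apply/(impact_lever Rad_gt0 ell_gt0); exists (- a); case: (Ro_lever az).
Qed.

Lemma I_minus_Ro : I_minus Rad ell z'.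
Proof.
have [az' NRo] := Ro_lever az; apply/(I_minusP Rad_gt0 ell_gt0).
by exists (- a); rewrite ?NRo ?oppr_ge0.
Qed.

(** Clockwise rotations are reflected into counterclockwise ones, whence the
    factor [Num.sg (omega z)] on the coordinates that a reflection reverses. *)
Lemma blade_end_rotation (t s b : R) (w0 : omega z != 0)
    (theta0 := angle_rep (theta_of z))
    (theta := theta0 + omega z * (s - t))
    (p := ((mid_of Rad ell z).1 + k * (sin theta - sin theta0),
           (mid_of Rad ell z).2 + k * (cos theta0 - cos theta))) :
  sqnorm2 (blade_end (Config (angle theta) p) b) =
  end_sq x (Num.sg (omega z) * y) (Num.sg (omega z) * k) b
         (`|omega z| * (s - t)).
Proof.
have g2 : Num.sg (omega z) ^+ 2 = 1 by rewrite sqr_sg w0.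
rewrite /blade_end /sqnorm2 /= cosS_angle sinS_angle /p mid_of_frame /=.
have -> : theta = theta0 + Num.sg (omega z) * (`|omega z| * (s - t)).
  by rewrite mulrA -numEsg.
have -> : cosS (theta_of z) = cos theta0 by [].
have -> : sinS (theta_of z) = sin theta0 by [].
rewrite /end_sq cosD sinD cos_sg// sin_sg.
move: (Num.sg _) (cos (_ * _)) (sin (_ * _)) g2 => g cu su g2.
have := cos2Dsin2 theta0; move: (cos theta0) (sin theta0) k => c s0 K cs.
have -> : (g * (Rad * S + K) + b * su - g * K * cu) ^+ 2 =
    (Rad * S + K + b * (g * su) - K * cu) ^+ 2.
  by rewrite -[RHS]mul1r -[X in _ = X * _]g2 -exprMn; congr (_ ^+ 2);
     rewrite -[b * su]mul1r -g2; ring.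
rewrite -[RHS]mul1r -cs; ring.
Qed.

Lemma flight_rotation (t : R) : omega z != 0 ->
  exists t', pre_impact Rad ell t z t' z'.
Proof.
move=> w0; have aw : 0 < `|omega z| by rewrite normr_gt0.
have g2 : Num.sg (omega z) ^+ 2 = 1 by rewrite sqr_sg w0.
have [_ a2 _] := az.
(* The left-hand side is [Rad * N / |omega|]. *)
have lean : Num.sg (omega z) * y * a + x * (Num.sg (omega z) * k) <= 0.
  have -> : Num.sg (omega z) * y * a + x * (Num.sg (omega z) * k) =
      Rad * `|omega z| / omega z ^+ 2 * normal_speed z a.
    by rewrite normrEsg /normal_speed; field.
  by rewrite mulr_ge0_le0// mulr_ge0 ?invr_ge0 ?sqr_ge0// mulr_ge0// ltW.
have [u [u0 inside cu su]] := first_return xa_gt0 lean.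
set R2 := end_sq _ _ _ _ _ in inside.
pose theta s := angle_rep (theta_of z) + omega z * (s - t).
pose p s :=
  ((mid_of Rad ell z).1 + k * (sin (theta s) - sin (angle_rep (theta_of z))),
   (mid_of Rad ell z).2 + k * (cos (angle_rep (theta_of z)) - cos (theta s))).
have motion : smooth_motion (omega z) (vel z) theta p.
  exact: smooth_motion_rotation.
pose t' := t + u / `|omega z|.
have startE : Config (angle (theta t)) (p t) = config_of Rad ell z.
  rewrite /p /theta subrr mulr0 addr0 !subrr mulr0 !addr0 angle_repK.
  by rewrite /config_of; case: (mid_of _ _ _).
have R2E : R2 = Rad ^+ 2.
  rewrite /R2 -(sqnorm_scale_dir Rad (phi z)) -(contact_end Rad_gt0 ell_gt0 az).
  rewrite -startE blade_end_rotation//.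
  by rewrite subrr mulr0.
have tau : omega z * (t' - t) = Num.sg (omega z) * u.
  rewrite /t' addrAC subrr add0r {1}[omega z]numEsg; field.
  by rewrite gt_eqF.
have angE : angle (omega z * (t' - t)) = Omega Rad ell z + vth z *+ 2 + angle pi.
  have [cO sO] := Omega_rotation w0; have d0 := sqr_dist_gt0.
  have gy2 : (Num.sg (omega z) * y) ^+ 2 = y ^+ 2 by rewrite exprMn g2 mul1r.
  apply: circle_eq.
    rewrite cosS_Dpi cO cosS_angle tau cos_sg// cu gy2 -[RHS]mulNr.
    by congr (_ / _); ring.
  rewrite sinS_Dpi sO sinS_angle tau sin_sg su gy2.
  rewrite -[RHS]mulNr mulrA; congr (_ / _).
  by rewrite -[RHS]mul1r -[X in _ = X * _]g2; ring.
have thE : angle (theta t') = theta_of z'.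
  by rewrite theta_of_Ro -angE angleD angle_repK.
have endE : config_of Rad ell z' = Config (angle (theta t')) (p t').
  rewrite /config_of thE; congr Config.
  rewrite mid_of_Ro /p mid_of_frame.
  rewrite -(cosS_angle (theta t')) -(sinS_angle (theta t')) thE.
  have -> : theta_of z' = theta_of z + angle (omega z * (t' - t)).
    by rewrite angE theta_of_Ro.
  have d0 := sqr_dist_gt0.
  have [cO sO] := Omega_rotation w0.
  rewrite cosSD sinSD angE cosS_Dpi sinS_Dpi cO sO.
  rewrite -[cos (angle_rep _)]/(cosS (theta_of z)).
  rewrite -[sin (angle_rep _)]/(sinS (theta_of z)).
  move: (cosS (theta_of z)) (sinS (theta_of z)) => c s.
  have d_neq0 : x ^+ 2 + y ^+ 2 != 0 by rewrite gt_eqF.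
  rewrite /=; move: d_neq0; set X := x; set Y := y => d_neq0.
  have -> : Rad * S = Y - k by rewrite /Y; ring.
  by move: X Y k d_neq0 => {}X {}Y K d_neq0; congr pair; field; rewrite d_neq0.
exists t', theta, p => /=; split => //.
- by rewrite ltrDl divr_gt0.
- split; first by rewrite -endE; apply: impact_on_surface impact_Ro.
  move=> s /andP[ts st]; rewrite /on_impact_surface (h_blade_end _ a2).
  apply/eqP; rewrite lt_eqF//.
  have us : 0 < `|omega z| * (s - t) < u.
    rewrite pmulr_rgt0// subr_gt0 ts /=.
    by rewrite -ltr_pdivlMl// ltrBlDl mulrC.
  have [i1 i2] := inside _ us.
  by rewrite gt_max !blade_end_rotation// -R2E i1 i2.
- by split => //; exact: I_minus_Ro.
Qed.

(** The blade slides along its line, away from the contact point.  Measured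
    from the foot of the perpendicular from the origin, the contact end starts
    at [x + a] and the other one at [x - a]; the latter reaches [- (x + a)]
    after the midpoint has moved by [- 2 * x]. *)
Lemma flight_translation (t : R) : omega z = 0 ->
  exists t', pre_impact Rad ell t z t' z'.
Proof.
move=> w0; have [nz a2 aC] := az.
have v0 : vel z != 0.
  by apply/eqP => v0; apply: nz; rewrite w0 v0.
have vC : vel z * C <= 0 by move: Nz; rewrite /normal_speed w0 mulr0 mul0r addr0.
have a_gt0 : 0 < a ^+ 2 by rewrite exprn_even_gt0// (lever_neq0 az).
have Ca : 0 < C * a.
  by rewrite -(pmulr_rgt0 _ Rad_gt0); apply: lt_trans a_gt0 _; lra.
have va : vel z * a < 0.
  have va0 : vel z * a != 0 by rewrite mulf_neq0// (lever_neq0 az).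
  rewrite lt_neqAle va0 leNgt; apply/negP => va.
  have : 0 < (vel z * a) * (C * a) by exact: mulr_gt0.
  rewrite (_ : _ * _ = (vel z * C) * a ^+ 2); last by ring.
  by rewrite pmulr_lgt0// ltNge vC.
have OE : Omega Rad ell z = - (vth z *+ 2) + angle pi.
  rewrite /Omega mem_set//; split => //; split.
    by apply/impact_lever => //; exists a.
  rewrite (N_lever Rad_gt0 ell_gt0 az) /normal_speed w0 mulr0 mul0r addr0.
  rewrite lt_neqAle vC andbT mulf_neq0//.
  by apply: contraTneq Ca => ->; rewrite mul0r ltxx.
have thE : theta_of z' = theta_of z.
  by rewrite theta_of_Ro OE [- _ + _]addrC subrK angle_pi2 addr0.
pose p s := ((mid_of Rad ell z).1 + vel z * (s - t) * cosS (theta_of z),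
             (mid_of Rad ell z).2 + vel z * (s - t) * sinS (theta_of z)).
have motion : smooth_motion (omega z) (vel z) (fun=> angle_rep (theta_of z)) p.
  by rewrite w0; exact: smooth_motion_translation.
pose t' := t - 2 * x / vel z.
have startE : Config (theta_of z) (p t) = config_of Rad ell z.
  by rewrite /p !subrr mulr0 !mul0r !addr0 /config_of; case: (mid_of _ _ _).
have endE : config_of Rad ell z' = Config (theta_of z) (p t').
  rewrite /config_of thE; congr Config.
  rewrite mid_of_Ro thE /p mid_of_frame.
  have -> : vel z * (t' - t) = - (2 * x) by rewrite /t'; field.
  by congr pair => /=; ring.
have sqE s b : sqnorm2 (blade_end (Config (theta_of z) (p s)) b) =
    (x + b + vel z * (s - t)) ^+ 2 + (Rad * S) ^+ 2.
  rewrite /blade_end /sqnorm2 /p mid_of_frame /=.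
  have := cos2Dsin2S (theta_of z); move: (cosS (theta_of z)) (sinS (theta_of z)).
  by move=> c s0 cs; rewrite -[RHS]mul1r -cs; ring.
have R2E : Rad ^+ 2 = (x + a) ^+ 2 + (Rad * S) ^+ 2.
  by rewrite -[LHS]mulr1 -(cos2Dsin2S (vth z)); ring.
exists t', (fun=> angle_rep (theta_of z)), p => /=.
rewrite angle_repK; split => //.
- rewrite /t' ltrDl oppr_gt0.
  have -> : 2 * x / vel z = 2 * (x * a) * (vel z * a) / (vel z * a) ^+ 2.
    by field; rewrite v0 (lever_neq0 az).
  have va2 : 0 < (vel z * a) ^+ 2 by rewrite exprn_even_gt0//= lt_eqF.
  by rewrite pmulr_llt0 ?invr_gt0// pmulr_rlt0// mulr_gt0// xa_gt0.
- split; first by rewrite -endE; apply: impact_on_surface impact_Ro.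
  move=> s /andP[ts st]; rewrite /on_impact_surface (h_blade_end _ a2).
  apply/eqP; rewrite lt_eqF// gt_max !sqE R2E !ltrD2r.
  have d1 : a * (vel z * (s - t)) < 0.
    by rewrite mulrA [a * _]mulrC nmulr_rlt0// subr_gt0.
  have d2 : - (2 * (x * a)) < a * (vel z * (s - t)).
    have -> : - (2 * (x * a)) = vel z * a * (t' - t) by rewrite /t'; field.
    by rewrite mulrA [a * _]mulrC ltr_nM2l// ltrD2r.
  (* Multiplying by [a ^ 2] makes the signs independent of the end in
     contact. *)
  have neg (e : R) : a ^+ 2 * e < 0 -> e < 0 by rewrite pmulr_rlt0.
  apply/andP; split; rewrite -subr_lt0; apply: neg.
    rewrite (_ : _ * _ = (a * (vel z * (s - t))) *
      (2 * (x * a) + 2 * a ^+ 2 + a * (vel z * (s - t)))); last by ring.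
    by rewrite nmulr_rlt0//; lra.
  rewrite (_ : _ * _ = (a * (vel z * (s - t)) - 2 * a ^+ 2) *
     (2 * (x * a) + a * (vel z * (s - t)))); last by ring.
  by rewrite nmulr_rlt0; lra.
- by split => //; exact: I_minus_Ro.
Qed.

End Flight.
(** * Uniqueness of the next impact *)

Lemma pre_impact_unique (R : realType) (Rad ell t t1 t2 : R) (z z1 z2 : state R)
    (Rad_gt0 : 0 < Rad) (ell_gt0 : 0 < ell) :
  pre_impact Rad ell t z t1 z1 -> pre_impact Rad ell t z t2 z2 -> z1 = z2.
Proof.
have imp u : I_minus Rad ell u -> impact Rad ell u by case=> -[].
move=> [th1 [p1 /= [m1 s1 tt1 [on1 off1] [/imp i1 c1 w1 v1]]]].
move=> [th2 [p2 /= [m2 s2 tt2 [on2 off2] [/imp i2 c2 w2 v2]]]].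
have qE s : Config (angle (th1 s)) (p1 s) = Config (angle (th2 s)) (p2 s).
  have [tE pE] : angle (th1 t) = angle (th2 t) /\ p1 t = p2 t.
    by have := etrans s1 (esym s2) => -[].
  by have [-> ->] := smooth_motion_unique m1 m2 tE pE s.
have t12 : t1 = t2.
  apply/eqP; case: ltgtP => // lt12; exfalso.
    by apply: (off2 t1); rewrite ?tt1// -qE.
  by apply: (off1 t2); rewrite ?tt2// qE.
apply: (config_of_inj Rad_gt0 ell_gt0 i1 i2); rewrite ?w1 ?w2 ?v1 ?v2//.
by rewrite c1 c2 t12 qE.
Qed.

Theorem corollary2 (R : realType) (Rad ell m J : R)
    (Rad_gt0 : 0 < Rad) (ell_gt0 : 0 < ell) (m_gt0 : 0 < m) (J_gt0 : 0 < J) :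
  (forall z : state R, I_plus Rad ell z ->
     I_minus Rad ell (Ro Rad ell z) /\ I_plus Rad ell (T Rad ell m J z)) /\
  (forall (t : R) (z : state R), I_plus Rad ell z ->
     forall z' : state R,
       (exists t' : R, next_post_impact Rad ell m J t z t' z') <->
       z' = T Rad ell m J z).
Proof.
split=> [z /(I_plusP Rad_gt0 ell_gt0)[a az Nz]|t z].
  have [az' NRo] := Ro_lever az.
  have Nz' : 0 <= normal_speed (Ro Rad ell z) (- a) by rewrite NRo oppr_ge0.
  split; first by apply/I_minusP => //; exists (- a).
  have [azT NT] := impact_map_lever Rad_gt0 ell_gt0 m_gt0 J_gt0 az' Nz'.
  by apply/I_plusP => //; exists (- a); rewrite ?NT ?oppr_le0.
move=> /(I_plusP Rad_gt0 ell_gt0)[a az Nz] z'.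
have [t1 flight] : exists t1, pre_impact Rad ell t z t1 (Ro Rad ell z).
  have [w0|w0] := eqVneq (omega z) 0; first exact: flight_translation az Nz t w0.
  exact: flight_rotation az Nz t w0.
split=> [[t' [zm zmE ->]]|->]; last by exists t1, (Ro Rad ell z).
by rewrite /T (pre_impact_unique Rad_gt0 ell_gt0 flight zmE).
Qed.
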